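(* Let $A,B$ be free noncommutative variables. Then, in $\exp(\hat{\mathfrak f}_2)$, $$\Phi(A,B)=4^{B}\,\Psi_2(A\,|\,2B,-2(A+B))\,4^{A},$$ where $\Phi$ is the Knizhnik–Zamolodchikov associator and $\Psi_2$ is its analogue for square roots of unity, as defined in the context.
   Context: Let $\hat{\mathfrak f}_2$ (resp. $\hat{\mathfrak f}_3$) be the topologically free complex Lie algebra generated by $A,B$ (resp. $A,b_0,b_1$), i.e. the degree completion of the free Lie algebra, all generators having degree $1$. For $x$ in a pronilpotent Lie algebra and $a\in\mathbb C\setminus\mathbb R_-$, $a^x:=\exp(x\ln a)$, where $\ln a$ has imaginary part in $]-\pi,\pi[$. Definition of $\Phi$: $\Phi(A,B)=G_1^{-1}G_0\in\exp(\hat{\mathfrak f}_2)$, where $G_0,G_1$ are the $\exp(\hat{\mathfrak f}_2)$-valued solutions on $]0,1[$ of $$(dG)G^{-1}=\Big(\frac{A}{u}+\frac{B}{u-1}\Big)du$$ such that $G_0(u)\simeq u^{A}$ as $u\to0^+$ and $G_1(u)\simeq(1-u)^{B}$ as $u\to1^-$ (i.e. $G_0(u)u^{-A}\to1$, $G_1(u)(1-u)^{-B}\to1$). Definition of $\Psi_2$: $\Psi_2(A|b_0,b_1)=H_1^{-1}H_0\in\exp(\hat{\mathfrak f}_3)$, where $H_0,H_1$ are the $\exp(\hat{\mathfrak f}_3)$-valued solutions on $]0,1[$ of $$(dH)H^{-1}=\Big(\frac{A}{z}+\frac{b_0}{z-1}+\frac{b_1}{z+1}\Big)dz$$ such that $H_0(z)\simeq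 z^{A}$ as $z\to0^+$ and $H_1(z)\simeq(1-z)^{b_0}$ as $z\to1^-$ (same meaning of $\simeq$). For degree-one elements $x,y_0,y_1$ of a degree-completed graded Lie algebra $\hat{\mathfrak g}$ (with $\mathfrak g$ generated in degree $1$), $\Psi_2(x|y_0,y_1)\in\exp(\hat{\mathfrak g})$ denotes the image of $\Psi_2(A|b_0,b_1)$ under the morphism induced by $A\mapsto x$, $b_0\mapsto y_0$, $b_1\mapsto y_1$. *)

(* Defs.v *)
From HB Require Import structures.
From mathcomp Require Import all_boot all_order all_algebra.
From mathcomp Require Import all_classical all_reals all_analysis.
From mathcomp Require Import complex.

Set Implicit Arguments.
Unset Strict Implicit.
Unset Printing Implicit Defensive.

Import Order.TTheory GRing.Theory Num.Theory.
Import numFieldNormedType.Exports.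

Local Open Scope classical_set_scope.
Local Open Scope ring_scope.
Local Open Scope complex_scope.

(* Noncommutative formal power series over the finite alphabet T, i.e. the
   degree completion K<<T>> of the free associative algebra; [f w] is the
   coefficient of the word [w]. *)
Definition ncseries (K : fieldType) (T : finType) : Type := seq T -> K.

Section Algebra.
Variables (K : fieldType) (T : finType).
Local Notation S := (ncseries K T).

HB.instance Definition _ := gen_eqMixin S.
HB.instance Definition _ := gen_choiceMixin S.

Definition nc_zero : S := fun=> 0.
Definition nc_opp (f : S) : S := fun w => - f w.
Definition nc_add (f g : S) : S := fun w => f w + g w.
Definition nc_scale (a : K) (f : S) : S := fun w => a * f w.
Definition nc_one : S := fun w => (nilp w)%:R.
Definition nc_mul (f g : S) : S :=
  fun w => \sum_(i < (size w).+1) f (take i w) * g (drop i w).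

Fact nc_addA : associative nc_add.
Proof. by move=> f g h; apply/funext => w; rewrite /nc_add addrA. Qed.
Fact nc_addC : commutative nc_add.
Proof. by move=> f g; apply/funext => w; rewrite /nc_add addrC. Qed.
Fact nc_add0 : left_id nc_zero nc_add.
Proof. by move=> f; apply/funext => w; rewrite /nc_add add0r. Qed.
Fact nc_addN : left_inverse nc_zero nc_opp nc_add.
Proof. by move=> f; apply/funext => w; rewrite /nc_add /nc_opp addNr. Qed.

HB.instance Definition _ :=
  GRing.isZmodule.Build S nc_addA nc_addC nc_add0 nc_addN.

Let shift (x : T) (f : S) : S := fun w => f (x :: w).

Fact nc_mul_nil (f g : S) : nc_mul f g [::] = f [::] * g [::].
Proof. by rewrite /nc_mul big_ord1. Qed.

Fact nc_mul_cons (f g : S) x w :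
  nc_mul f g (x :: w) = f [::] * g (x :: w) + nc_mul (shift x f) g w.
Proof. by rewrite /nc_mul /= big_ord_recl. Qed.

Fact nc_mulDl : left_distributive nc_mul +%R.
Proof.
move=> f g h; apply/funext => w; rewrite /nc_mul -[RHS]big_split /=.
by apply: eq_bigr => i _; rewrite -mulrDl.
Qed.

Fact nc_mulDr : right_distributive nc_mul +%R.
Proof.
move=> f g h; apply/funext => w; rewrite /nc_mul -[RHS]big_split /=.
by apply: eq_bigr => i _; rewrite -mulrDr.
Qed.

Fact nc_scaleAl a (f g : S) :
  nc_scale a (nc_mul f g) = nc_mul (nc_scale a f) g.
Proof.
apply/funext => w; rewrite /nc_scale /nc_mul big_distrr /=.
by apply: eq_bigr => i _; rewrite mulrA.
Qed.

Fact nc_scaleAr a (f g : S) :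
  nc_scale a (nc_mul f g) = nc_mul f (nc_scale a g).
Proof.
apply/funext => w; rewrite /nc_scale /nc_mul big_distrr /=.
by apply: eq_bigr => i _; rewrite mulrCA.
Qed.

Fact nc_mulA : associative nc_mul.
Proof.
move=> f g h; apply/funext => w; elim: w f g h => [|x w IHw] f g h.
  by rewrite !nc_mul_nil mulrA.
have -> : nc_mul (nc_mul f g) h (x :: w) = f [::] * g [::] * h (x :: w)
    + (f [::] * nc_mul (shift x g) h w + nc_mul (nc_mul (shift x f) g) h w).
  rewrite nc_mul_cons nc_mul_nil; congr (_ + _).
  have -> : shift x (nc_mul f g) =
      nc_scale (f [::]) (shift x g) + nc_mul (shift x f) g.
    by apply/funext => v; rewrite /shift nc_mul_cons.
  by rewrite nc_mulDl -nc_scaleAl.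
by rewrite nc_mul_cons IHw nc_mul_cons mulrDr mulrA addrA.
Qed.

Fact nc_mul1l : left_id nc_one nc_mul.
Proof.
move=> f; apply/funext => w; rewrite /nc_mul big_ord_recl take0 drop0 mul1r.
rewrite big1 ?addr0// => i _; rewrite /nc_one /nilp size_take /=.
by case: (w) i => [[]//|x v] i /=; case: ifP; rewrite mul0r.
Qed.

Fact nc_mul1r : right_id nc_one nc_mul.
Proof.
move=> f; apply/funext => w; rewrite /nc_mul big_ord_recr /=.
rewrite take_size drop_size mulr1 big1 ?add0r// => i _.
by rewrite /nc_one /nilp size_drop subn_eq0 leqNgt ltn_ord mulr0.
Qed.

Fact nc_one_neq0 : nc_one != 0 :> S.
Proof.
by apply/eqP => /(congr1 (fun f : S => f [::])) /eqP; rewrite oner_eq0.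
Qed.

HB.instance Definition _ := GRing.Zmodule_isNzRing.Build S
  nc_mulA nc_mul1l nc_mul1r nc_mulDl nc_mulDr nc_one_neq0.

Fact nc_scaleA a b (f : S) : nc_scale a (nc_scale b f) = nc_scale (a * b) f.
Proof. by apply/funext => w; rewrite /nc_scale mulrA. Qed.
Fact nc_scale1 : left_id 1 nc_scale.
Proof. by move=> f; apply/funext => w; rewrite /nc_scale mul1r. Qed.
Fact nc_scaleDr : right_distributive nc_scale +%R.
Proof. by move=> a f g; apply/funext => w; apply: mulrDr. Qed.
Fact nc_scaleDl f : {morph nc_scale^~ f : a b / a + b}.
Proof. by move=> a b; apply/funext => w; apply: mulrDl. Qed.

HB.instance Definition _ := GRing.Zmodule_isLmodule.Build K S
  nc_scaleA nc_scale1 nc_scaleDr nc_scaleDl.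
HB.instance Definition _ := GRing.Lmodule_isLalgebra.Build K S nc_scaleAl.
HB.instance Definition _ := GRing.Lalgebra_isAlgebra.Build K S nc_scaleAr.

Lemma nc0E w : (0 : S) w = 0. Proof. by []. Qed.
Lemma nc1E w : (1 : S) w = (nilp w)%:R. Proof. by []. Qed.
Lemma ncDE (f g : S) w : (f + g) w = f w + g w. Proof. by []. Qed.
Lemma ncNE (f : S) w : (- f) w = - f w. Proof. by []. Qed.
Lemma ncZE a (f : S) w : (a *: f) w = a * f w. Proof. by []. Qed.
Lemma ncME (f g : S) w :
  (f * g) w = \sum_(i < (size w).+1) f (take i w) * g (drop i w).
Proof. by []. Qed.
Lemma ncM_nil (f g : S) : (f * g) [::] = f [::] * g [::].
Proof. exact: nc_mul_nil. Qed.
Lemma nc_sumE (J : Type) (r : seq J) (P : pred J) (F : J -> S) w :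
  (\sum_(j <- r | P j) F j) w = \sum_(j <- r | P j) F j w.
Proof. by elim/big_rec2: _ => // j y1 y2 _ <-. Qed.

Lemma nc_expr_small (h : S) k w :
  h [::] = 0 -> (size w < k)%N -> (h ^+ k) w = 0.
Proof.
move=> h0; elim: k w => // k IHk w lt_wk; rewrite exprS ncME big1// => i _.
case: i => -[|i] lt_i /=; first by rewrite take0 h0 mul0r.
rewrite [X in _ * X]IHk ?mulr0// size_drop.
by case: (size w) lt_i lt_wk => // m _; rewrite subSS ltnS => /(leq_ltn_trans _)
  ->//; rewrite leq_subr.
Qed.

(* Geometric series; inverse of [1 - h] when [h] has no constant term. *)
Definition nc_geom (h : S) : S :=
  fun w => \sum_(k < (size w).+1) (h ^+ k) w.

Lemma nc_geomE (h : S) N w : h [::] = 0 -> (size w <= N)%N ->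
  nc_geom h w = (\sum_(k < N.+1) h ^+ k) w.
Proof.
move=> h0 le_wN; rewrite nc_sumE /nc_geom.
rewrite -(big_mkord xpredT (fun k => (h ^+ k) w)).
rewrite -(big_mkord xpredT (fun k => (h ^+ k) w)) [RHS](@big_cat_nat _ _ _
  (size w).+1)//= -[LHS]addr0; congr (_ + _).
rewrite big_nat_cond big1// => k /andP[/andP[le_k _] _].
exact: nc_expr_small.
Qed.


Fact nc_geomK (h : S) :
  h [::] = 0 -> (1 - h) * nc_geom h = 1 /\ nc_geom h * (1 - h) = 1.
Proof.
move=> h0; pose g n : S := \sum_(k < n.+1) h ^+ k.
have gK n : (1 - h) * g n = 1 - h ^+ n.+1.
  by rewrite -opprB mulNr -subrX1 opprB.
have gC n : (1 - h) * g n = g n * (1 - h).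
  apply: commr_sum => k _; apply: commrX; apply: commr_sym.
  by apply: commrB; [exact: commr1 | exact: commr_refl].
have gw n w : (size w <= n)%N -> nc_geom h w = g n w.
  exact: nc_geomE.
split; apply/funext => w.
  transitivity (((1 - h) * g (size w)) w).
    by rewrite !ncME; apply: eq_bigr => i _; rewrite -gw// size_drop leq_subr.
  by rewrite gK ncDE ncNE nc_expr_small// subr0.
transitivity ((g (size w) * (1 - h)) w).
  by rewrite !ncME; apply: eq_bigr => i _; rewrite -gw// size_take_min geq_minr.
by rewrite -gC gK ncDE ncNE nc_expr_small// subr0.
Qed.

Definition nc_unit : pred S := fun f => f [::] != 0.
Definition nc_inv (f : S) : S :=
  if f [::] == 0 then f
  else (f [::])^-1 *: nc_geom (1 - (f [::])^-1 *: f).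

Fact nc_invK (f : S) : nc_unit f -> nc_inv f * f = 1 /\ f * nc_inv f = 1.
Proof.
rewrite /nc_unit /nc_inv => f0; rewrite (negbTE f0).
set c := f [::]; set h := 1 - c^-1 *: f.
have h0 : h [::] = 0.
  by rewrite /h ncDE ncNE ncZE nc1E -/c mulVf// subrr.
have hf : c^-1 *: f = 1 - h by rewrite opprB addrCA subrr addr0.
have [hl hr] := nc_geomK h0.
by split; [rewrite -scalerAl scalerAr hf | rewrite -scalerAr scalerAl hf].
Qed.

Fact nc_mulVr : {in nc_unit, left_inverse 1 nc_inv *%R}.
Proof. by move=> f /nc_invK[]. Qed.
Fact nc_mulrV : {in nc_unit, right_inverse 1 nc_inv *%R}.
Proof. by move=> f /nc_invK[]. Qed.
Fact nc_unitP (f g : S) : g * f = 1 /\ f * g = 1 -> nc_unit f.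
Proof.
move=> [_ /(congr1 (fun f : S => f [::]))]; rewrite ncM_nil nc1E => fg.
by apply/eqP => f0; move/eqP: fg; rewrite f0 mul0r eq_sym oner_eq0.
Qed.
Fact nc_inv_out : {in [predC nc_unit], nc_inv =1 id}.
Proof. by move=> f; rewrite inE negbK /nc_inv => ->. Qed.

HB.instance Definition _ := GRing.NzRing_hasMulInverse.Build S
  nc_mulVr nc_mulrV nc_unitP nc_inv_out.

Definition nc_gen (i : T) : S := fun w => (w == [:: i])%:R.

(* The exponential series, meaningful for [x] without constant term: then
   [x ^+ k] has no term in degree [< k], so only [k <= size w] contribute. *)
Definition nc_exp (x : S) : S :=
  fun w => \sum_(k < (size w).+1) (x ^+ k) w / (k`!)%:R.

(* The free Lie algebra on T, realised as the Lie subalgebra of the free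
   associative algebra generated by the letters. *)
Inductive lie_poly : S -> Prop :=
| lie_poly_gen i : lie_poly (nc_gen i)
| lie_poly0 : lie_poly 0
| lie_polyD x y : lie_poly x -> lie_poly y -> lie_poly (x + y)
| lie_polyZ a x : lie_poly x -> lie_poly (a *: x)
| lie_poly_bracket x y : lie_poly x -> lie_poly y -> lie_poly (x * y - y * x).

Definition nc_homog (n : nat) (f : S) : S :=
  fun w => if size w == n then f w else 0.

(* Its degree completion: the product of its homogeneous components. *)
Definition lie_series (x : S) : Prop := forall n, lie_poly (nc_homog n x).

Definition exp_lie (g : S) : Prop := exists2 x, lie_series x & g = nc_exp x.

End Algebra.

(* The continuous algebra morphism sending the letter [i] to [y i], where the
   [y i] have no constant term: words of length [> size w] cannot contribute
   to the coefficient of [w]. *)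
Definition nc_subst (K : fieldType) (T U : finType) (y : T -> ncseries K U)
    (f : ncseries K T) : ncseries K U :=
  fun w => \sum_(k < (size w).+1) \sum_(v : k.-tuple T)
    f v * (\prod_(i <- v) y i) w.

Section Associators.
Variable R : realType.

(* C = R[i] carries the topology of R^2, so derivatives and limits of
   complex-valued functions are taken on real and imaginary parts. *)
Definition is_cderive (g : R -> R[i]) (u : R) (l : R[i]) : Prop :=
  is_derive u 1 (fun t => complex.Re (g t)) (complex.Re l) /\
  is_derive u 1 (fun t => complex.Im (g t)) (complex.Im l).

(* Series are differentiated, and converge, in the inverse-limit topology of
   the finite-dimensional truncations, i.e. coefficientwise. *)
Definition is_nc_derive (T : finType) (G : R -> ncseries R[i] T) (u : R)
    (D : ncseries R[i] T) : Prop :=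
  forall w, is_cderive (fun t => G t w) u (D w).

Definition nc_cvg (T : finType) (F : set_system R)
    (G : R -> ncseries R[i] T) (l : ncseries R[i] T) : Prop :=
  forall w, complex.Re (G u w) @[u --> F] --> complex.Re (l w) /\
            complex.Im (G u w) @[u --> F] --> complex.Im (l w).

(* [a^x = exp (x ln a)]; on positive reals the principal logarithm is [ln]. *)
Definition nc_pow (T : finType) (a : R) (x : ncseries R[i] T) :
    ncseries R[i] T := nc_exp ((ln a)%:C *: x).

(* [G] is an [exp(f^)]-valued solution of [(dG) G^-1 = omega(u) du] on
   the open interval (0,1); its values elsewhere are irrelevant. *)
Definition solves (T : finType) (omega G : R -> ncseries R[i] T) : Prop :=
  forall u : R, 0 < u < 1 ->
    exp_lie (G u) /\
    exists2 D, is_nc_derive G u D & D * (G u)^-1 = omega u.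

Definition f2_A : ncseries R[i] 'I_2 := nc_gen R[i] (@Ordinal 2 0 isT).
Definition f2_B : ncseries R[i] 'I_2 := nc_gen R[i] (@Ordinal 2 1 isT).
Definition f3_A : ncseries R[i] 'I_3 := nc_gen R[i] (@Ordinal 3 0 isT).
Definition f3_b0 : ncseries R[i] 'I_3 := nc_gen R[i] (@Ordinal 3 1 isT).
Definition f3_b1 : ncseries R[i] 'I_3 := nc_gen R[i] (@Ordinal 3 2 isT).

Definition form_Phi (u : R) : ncseries R[i] 'I_2 :=
  (u^-1)%:C *: f2_A + ((u - 1)^-1)%:C *: f2_B.

Definition form_Psi2 (z : R) : ncseries R[i] 'I_3 :=
  (z^-1)%:C *: f3_A + ((z - 1)^-1)%:C *: f3_b0 + ((z + 1)^-1)%:C *: f3_b1.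

(* The quotient of two solutions is constant on (0,1), hence the quantifier
   over [u] in the last clause of the next two definitions. *)
Definition is_Phi (Phi : ncseries R[i] 'I_2) : Prop :=
  exists G0 G1 : R -> ncseries R[i] 'I_2,
    [/\ solves form_Phi G0,
        nc_cvg 0^'+ (fun u => G0 u * nc_pow u (- f2_A)) 1,
        solves form_Phi G1,
        nc_cvg 1^'- (fun u => G1 u * nc_pow (1 - u) (- f2_B)) 1
      & forall u, 0 < u < 1 -> Phi = (G1 u)^-1 * G0 u].

Definition is_Psi2 (Psi2 : ncseries R[i] 'I_3) : Prop :=
  exists H0 H1 : R -> ncseries R[i] 'I_3,
    [/\ solves form_Psi2 H0,
        nc_cvg 0^'+ (fun z => H0 z * nc_pow z (- f3_A)) 1,
        solves form_Psi2 H1,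
        nc_cvg 1^'- (fun z => H1 z * nc_pow (1 - z) (- f3_b0)) 1
      & forall z, 0 < z < 1 -> Psi2 = (H1 z)^-1 * H0 z].

(* [Psi2(x|y0,y1)]: the image of [Psi2] under A |-> x, b0 |-> y0, b1 |-> y1. *)
Definition f3_eval (T : finType) (Psi2 : ncseries R[i] 'I_3)
    (x y0 y1 : ncseries R[i] T) : ncseries R[i] T :=
  nc_subst (fun i : 'I_3 => nth 0 [:: x; y0; y1] i) Psi2.

End Associators.

(* Main.v *)
Require Import Defs.
From mathcomp Require Import all_boot all_order all_algebra.
From mathcomp Require Import all_classical all_reals all_analysis.
From mathcomp Require Import complex ring lra.

(** Everything comes from the rational map [u(z) = 4z / (1+z)^2], which fixes
    [0] and [1] and maps the interval [(0,1)] to itself.  Since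
    [1 - u = ((1-z) / (1+z))^2], one has
    [dlog u = dz/z - 2 dz/(z+1)] and
    [dlog (u-1) = 2 dz/(z-1) - 2 dz/(z+1)], so the form
    [A dlog u + B dlog (u-1)] defining [Phi] pulls back to the form defining
    [Psi2] with [b0 = 2B] and [b1 = -2(A+B)] (lemma [form_pullback]).  Hence,
    writing [phi] for this substitution of the letters, [G0(u(z))] and
    [phi(H0(z))] solve one and the same linear equation on [(0,1)], as do
    [G1(u(z))] and [phi(H1(z))], and each pair differs by a constant right
    factor.  These factors are read off from the behaviour at the end points:
    [u ~ 4z] at [0] gives [G0(u(z)) = phi(H0(z)) 4^A], and
    [1-u ~ (1-z)^2/4] at [1] gives [G1(u(z)) = phi(H1(z)) 4^(-B)].  Dividing
    the two identities gives the theorem.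

    Two points deserve care, and both are settled by induction on the length
    of words, i.e. by looking at the lowest nonzero homogeneous component.
    First, a solution which vanishes at one point vanishes on [(0,1)]: as the
    form has no constant term, the derivative of a coefficient only involves
    coefficients of shorter words ([flow_eq0]).  Second, the normalisations
    only say that [phi(H0(z)) z^(-A)] and [G0(u(z)) u^(-A)] tend to [1]
    coefficientwise, so the constant [E] to be identified appears through
    [z^A E z^(-A)], whose coefficients may grow like powers of [ln z].  No rate
    of convergence is needed, because conjugation does not change the lowest
    component of [E - 1] ([nc_cvg_conj_eq1]).  *)

Set Implicit Arguments.
Unset Strict Implicit.
Unset Printing Implicit Defensive.

Import Order.TTheory GRing.Theory Num.Theory.
Import numFieldNormedType.Exports.
Local Open Scope ring_scope.
Local Open Scope complex_scope.

(** * Noncommutative power series *)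

Lemma sum_antidiagonal (V : nmodType) (N : nat) (F : nat -> nat -> V) :
  (forall k l, (N < k + l)%N -> F k l = 0) ->
  \sum_(k < N.+1) \sum_(l < N.+1) F k l =
  \sum_(n < N.+1) \sum_(i < n.+1) F (n - i)%N i.
Proof.
move=> F0; rewrite exchange_big /=.
under [RHS]eq_bigr => n _ do
  rewrite (big_ord_widen N.+1 (fun i => F (n - i)%N i) (ltn_ord n)).
rewrite [RHS](exchange_big_dep xpredT)//=; apply: eq_bigr => -[l /= lN] _.
transitivity (\sum_(l <= i < N.+1) F (i - l)%N l); last first.
  by rewrite big_geq_mkord; apply: eq_bigl => i; rewrite ltnS.
rewrite -{2}[l]add0n big_addn -(big_mkord xpredT (F^~ l)).
rewrite (@big_cat_nat _ _ _ (N.+1 - l)) ?leq_subr//=.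
rewrite [X in _ + X]big_nat_cond [X in _ + X]big1 ?addr0.
  by apply: eq_bigr => i _; rewrite addnK.
by move=> k /andP[/andP[]]; rewrite leq_subLR addnC => /F0.
Qed.

Section NcAlgebra.
Variables (K : fieldType) (T : finType).
Implicit Types (f g h x : ncseries K T) (w : seq T).

Lemma ncM_eq0 (k l : nat) f g w :
  (forall v, (size v < k)%N -> f v = 0) ->
  (forall v, (size v < l)%N -> g v = 0) ->
  (size w < k + l)%N -> (f * g) w = 0.
Proof.
move=> f0 g0 lt_w; rewrite ncME big1// => i _.
have [lt_ik|le_ki] := ltnP i k.
  by rewrite f0 ?mul0r// size_take_min (leq_ltn_trans (geq_minl _ _)).
rewrite g0 ?mulr0// size_drop ltn_subLR ?(leq_trans lt_w) ?leq_add2r//.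
by rewrite -ltnS.
Qed.

(** The form in which inductions on word length use the absence of a constant
    term: multiplication by [h] raises the order. *)
Lemma eq_ncM_low h f g n w : h [::] = 0 ->
  (forall v, (size v < n)%N -> f v = g v) -> (size w <= n)%N ->
  (h * f) w = (h * g) w.
Proof.
move=> h0 fg wn; apply/eqP; rewrite -subr_eq0 -ncNE -ncDE -mulrBr; apply/eqP.
apply: (@ncM_eq0 1 n) => [[]// | v vn |]; last by rewrite add1n ltnS.
by rewrite ncDE ncNE fg// subrr.
Qed.

Lemma ncM_lowest_r f g w : (forall v, (size v < size w)%N -> g v = 0) ->
  (f * g) w = f [::] * g w.
Proof.
move=> g0; rewrite ncME big_ord_recl take0 drop0 big1 ?addr0// => i _.
rewrite [X in _ * X]g0 ?mulr0// size_drop /= /bump add1n.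
by rewrite ltn_subrL (leq_ltn_trans _ (ltn_ord i)).
Qed.

Lemma ncM_lowest_l f g w : (forall v, (size v < size w)%N -> f v = 0) ->
  (f * g) w = f w * g [::].
Proof.
move=> f0; rewrite ncME big_ord_recr /= take_size drop_size.
rewrite big1 ?add0r// => i _.
by rewrite f0 ?mul0r// size_take_min (leq_ltn_trans (geq_minl _ _)).
Qed.

Lemma nc_exp_nil x : nc_exp x [::] = 1.
Proof. by rewrite /nc_exp big_ord1 expr0 fact0 divr1 nc1E. Qed.

Lemma nc_exp0 : nc_exp (0 : ncseries K T) = 1.
Proof.
apply/funext => w; rewrite /nc_exp big_ord_recl expr0 fact0 divr1 big1 ?addr0//.
by move=> i _; rewrite expr0n mul0r.
Qed.

(** Replaces the length-dependent truncation in [nc_exp] by a uniform one, so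
    that algebraic identities can be applied to whole series. *)
Lemma nc_exp_trunc x N w : x [::] = 0 -> (size w <= N)%N ->
  nc_exp x w = (\sum_(k < N.+1) k`!%:R^-1 *: x ^+ k) w.
Proof.
move=> x0 wN; rewrite nc_sumE /nc_exp.
rewrite (big_ord_widen N.+1 (fun k => (x ^+ k) w / k`!%:R))// big_mkcond /=.
apply: eq_bigr => k _; rewrite ncZE mulrC; case: ltnP => // ?.
by rewrite nc_expr_small// mulr0.
Qed.

Lemma nc_inv_eq f g : f * g = 1 -> f [::] != 0 -> f^-1 = g.
Proof.
move=> fg f0; have fU : f \is a GRing.unit := f0.
by rewrite -[RHS](mulKr fU) fg mulr1.
Qed.

End NcAlgebra.

Lemma nc_expD (K : numFieldType) (T : finType) (x y : ncseries K T) :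
  x [::] = 0 -> y [::] = 0 -> GRing.comm x y ->
  nc_exp (x + y) = nc_exp x * nc_exp y.
Proof.
move=> x0 y0 xy; apply/funext => w; set N := size w.
have xy0 : (x + y) [::] = 0 by rewrite ncDE x0 y0 addr0.
transitivity ((\sum_(k < N.+1) \sum_(l < N.+1)
    (k`!%:R^-1 *: x ^+ k) * (l`!%:R^-1 *: y ^+ l)) w); last first.
  under eq_bigr => k _ do rewrite -mulr_sumr.
  rewrite -mulr_suml !ncME; apply: eq_bigr => i _.
  rewrite !(@nc_exp_trunc _ _ _ N) ?size_drop ?leq_subr//.
  by rewrite size_take_min geq_minr.
rewrite nc_sumE; under eq_bigr => k _ do rewrite nc_sumE.
rewrite (sum_antidiagonal (F := fun k l =>
    ((k`!%:R^-1 *: x ^+ k) * (l`!%:R^-1 *: y ^+ l)) w)); last first.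
  move=> k l kl; apply: (@ncM_eq0 _ _ k l) => // v /nc_expr_small v0;
    by rewrite ncZE v0// mulr0.
rewrite (@nc_exp_trunc _ _ _ N)// nc_sumE; apply: eq_bigr => n _.
rewrite exprDn_comm// scaler_sumr nc_sumE; apply: eq_bigr => i _.
rewrite -scalerAl -scalerAr scalerA.
rewrite -scalerMnr scalerMnl !ncZE; congr (_ * _).
have le_in : (i <= n)%N by rewrite -ltnS.
have fne0 m : m`!%:R != 0 :> K by rewrite pnatr_eq0 -lt0n fact_gt0.
rewrite -(bin_fact le_in) !natrM; field.
by rewrite !fne0 pnatr_eq0 -lt0n bin_gt0 le_in.
Qed.

(** * The substitution morphism *)

Section Substitution.
Variables (K : fieldType) (T U : finType) (y : T -> ncseries K U).
Hypothesis y0 : forall i, y i [::] = 0.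
Implicit Types (f g : ncseries K T) (w : seq U).

Let shift (x : T) f : ncseries K T := fun v => f (x :: v).

Lemma nc_prod_small (v : seq T) w :
  (size w < size v)%N -> (\prod_(i <- v) y i) w = 0.
Proof.
elim: v w => // x v IHv w lt_w; rewrite big_cons.
by apply: (@ncM_eq0 _ _ 1 (size v)) => // -[].
Qed.

Lemma nc_subst_trunc f N w : (size w <= N)%N ->
  nc_subst y f w =
  \sum_(k < N.+1) \sum_(v : k.-tuple T) f v * (\prod_(i <- v) y i) w.
Proof.
move=> wN; rewrite /nc_subst.
rewrite (big_ord_widen N.+1 (fun k => \sum_(v : k.-tuple T)
  f v * (\prod_(i <- v) y i) w))// big_mkcond /=.
apply: eq_bigr => k _; case: ltnP => // le_wk.
by rewrite big1// => v _; rewrite nc_prod_small ?mulr0 ?size_tuple.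
Qed.

(** Splitting words according to their first letter.  Together with the fact
    that the [y x] raise the order, this recursion makes it possible to prove
    multiplicativity of [nc_subst] by induction on the degree, with no
    manipulation of sums over tuples. *)
Lemma nc_substE f :
  nc_subst y f = f [::] *: 1 + \sum_x y x * nc_subst y (shift x f).
Proof.
apply/funext => w; rewrite ncDE ncZE nc_sumE /nc_subst big_ord_recl.
congr (_ + _).
  rewrite (bigD1 [tuple])//= big_nil big1 ?addr0// => v.
  by move=> /eqP nv; case: nv; apply: tuple0.
rewrite (eq_bigr (fun k : 'I_(size w) => \sum_x \sum_(v : k.-tuple T)
    shift x f v * (y x * \prod_(i <- v) y i) w)) => [|k _]; last first.
  rewrite pair_bigA /= /bump /= add1n.
  rewrite (reindex (fun p : T * k.-tuple T => [tuple of p.1 :: p.2])) /=.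
    by apply: eq_bigr => -[x v] _; rewrite big_cons.
  exists (fun t : k.+1.-tuple T => (thead t, [tuple of behead t]))
    => [[x v]|t] _.
    by congr pair; apply: val_inj.
  by rewrite [RHS]tuple_eta.
rewrite exchange_big /=; apply: eq_bigr => x _.
pose g : ncseries K U := \sum_(k < size w) \sum_(v : k.-tuple T)
  shift x f v *: \prod_(i <- v) y i.
transitivity ((y x * g) w).
  rewrite mulr_sumr nc_sumE; apply: eq_bigr => k _.
  rewrite mulr_sumr nc_sumE; apply: eq_bigr => v _.
  by rewrite -scalerAr ncZE.
apply: (@eq_ncM_low _ _ _ _ _ (size w)) => // v lt_v.
rewrite /g nc_sumE; case: (size w) lt_v => // N lt_v.
rewrite -[RHS]/(nc_subst y (shift x f) v) (@nc_subst_trunc _ N)//.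
apply: eq_bigr => k _.
by rewrite nc_sumE; apply: eq_bigr => t _; rewrite ncZE.
Qed.

Lemma nc_subst_nil f : nc_subst y f [::] = f [::].
Proof.
rewrite nc_substE ncDE ncZE nc1E mulr1 nc_sumE big1 ?addr0// => x _.
by rewrite ncM_nil y0 mul0r.
Qed.

Lemma nc_substZ a f : nc_subst y (a *: f) = a *: nc_subst y f.
Proof.
apply/funext => w; rewrite ncZE /nc_subst mulr_sumr; apply: eq_bigr => k _.
by rewrite mulr_sumr; apply: eq_bigr => v _; rewrite ncZE mulrA.
Qed.

Lemma nc_substD f g : nc_subst y (f + g) = nc_subst y f + nc_subst y g.
Proof.
apply/funext => w; rewrite ncDE /nc_subst -big_split; apply: eq_bigr => k _.
by rewrite -big_split; apply: eq_bigr => v _; rewrite ncDE mulrDl.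
Qed.

Lemma nc_subst0 : nc_subst y 0 = 0.
Proof. by rewrite -(scale0r 0) nc_substZ !scale0r. Qed.

Lemma nc_subst1 : nc_subst y 1 = 1.
Proof.
rewrite nc_substE nc1E scale1r big1 ?addr0// => x _.
have -> : shift x 1 = 0 by apply/funext.
by rewrite nc_subst0 mulr0.
Qed.

Lemma nc_subst_sum (J : Type) (r : seq J) (F : J -> ncseries K T) :
  nc_subst y (\sum_(j <- r) F j) = \sum_(j <- r) nc_subst y (F j).
Proof. exact: (big_morph _ nc_substD nc_subst0). Qed.

Lemma nc_substM f g : nc_subst y (f * g) = nc_subst y f * nc_subst y g.
Proof.
suff H n w : (size w < n)%N ->
    nc_subst y (f * g) w = (nc_subst y f * nc_subst y g) w.
  by apply/funext => w; apply: (H (size w).+1).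
elim: n f g w => // n IHn f g w lt_w.
rewrite (nc_substE f) (nc_substE (f * g)) mulrDl -scalerAl mul1r mulr_suml.
rewrite {1}(nc_substE g) ncM_nil !ncDE !ncZE ncDE ncZE mulrDr mulrA -addrA.
congr (_ + _); rewrite !nc_sumE mulr_sumr -big_split /=; apply: eq_bigr => x _.
have -> : shift x (f * g) = f [::] *: shift x g + shift x f * g.
  by apply/funext => v; rewrite /shift; apply: nc_mul_cons.
rewrite nc_substD nc_substZ mulrDr -scalerAr ncDE ncZE; congr (_ + _).
by rewrite -mulrA; apply: (@eq_ncM_low _ _ _ _ _ n) => // v; apply: IHn.
Qed.

Lemma nc_substX f n : nc_subst y (f ^+ n) = nc_subst y f ^+ n.
Proof.
by elim: n => [|n IHn]; rewrite ?expr0 ?nc_subst1// !exprS nc_substM IHn.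
Qed.

Lemma nc_subst_gen i : nc_subst y (nc_gen K i) = y i.
Proof.
rewrite nc_substE scale0r add0r.
have shE x : shift x (nc_gen K i) = (x == i)%:R *: 1.
  apply/funext => v; rewrite ncZE nc1E /shift /nc_gen eqseq_cons.
  by case: eqP; rewrite ?mul1r ?mul0r; case: v.
rewrite (bigD1 i)//= shE eqxx scale1r nc_subst1 mulr1 big1 ?addr0// => x.
by move=> /negbTE xi; rewrite shE xi scale0r nc_subst0 mulr0.
Qed.

Lemma nc_subst_exp x : x [::] = 0 ->
  nc_subst y (nc_exp x) = nc_exp (nc_subst y x).
Proof.
move=> x0; apply/funext => w; pose N := size w.
rewrite (@nc_exp_trunc _ _ _ N) ?nc_subst_nil//.
under eq_bigr => k _ do rewrite -nc_substX -nc_substZ.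
rewrite -nc_subst_sum; apply: eq_bigr => -[k kw] _; apply: eq_bigr => v _.
by rewrite (@nc_exp_trunc _ _ _ N)// size_tuple -ltnS.
Qed.

End Substitution.

(** * Differentiation and linear differential equations *)

Section Derivatives.
Variable R : realType.
Implicit Types (a b : R[i]) (T U : finType) (u : R).

Lemma ReD a b : complex.Re (a + b) = complex.Re a + complex.Re b.
Proof. by case: a b => [? ?] []. Qed.
Lemma ImD a b : complex.Im (a + b) = complex.Im a + complex.Im b.
Proof. by case: a b => [? ?] []. Qed.
Lemma ReM a b : complex.Re (a * b) =
  complex.Re a * complex.Re b - complex.Im a * complex.Im b.
Proof. by case: a b => [? ?] []. Qed.
Lemma ImM a b : complex.Im (a * b) =
  complex.Re a * complex.Im b + complex.Im a * complex.Re b.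
Proof. by case: a b => [? ?] []. Qed.


Lemma is_derive_add (f g : R -> R) u df dg : is_derive u 1 f df ->
  is_derive u 1 g dg -> is_derive u 1 (fun t => f t + g t) (df + dg).
Proof. exact: is_deriveD. Qed.

Lemma is_derive_mulr (f : R -> R) u df c : is_derive u 1 f df ->
  is_derive u 1 (fun t => f t * c) (df * c).
Proof.
move=> fdf; rewrite mulrC; under eq_fun do rewrite mulrC.
exact: is_deriveZ.
Qed.

Lemma cderive_add (f g : R -> R[i]) u a b : is_cderive f u a ->
  is_cderive g u b -> is_cderive (fun t => f t + g t) u (a + b).
Proof.
move=> [ref imf] [reg img]; split.
  by under eq_fun do rewrite ReD; rewrite ReD; apply: is_derive_add.
by under eq_fun do rewrite ImD; rewrite ImD; apply: is_derive_add.
Qed.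

Lemma cderive_mulr (f : R -> R[i]) u a c : is_cderive f u a ->
  is_cderive (fun t => f t * c) u (a * c).
Proof.
move=> [ref imf]; split.
  under eq_fun do rewrite ReM -mulrN; rewrite ReM -mulrN.
  by apply: is_derive_add; apply: is_derive_mulr.
under eq_fun do rewrite ImM; rewrite ImM.
by apply: is_derive_add; apply: is_derive_mulr.
Qed.

Lemma cderive_sum (J : Type) (r : seq J) (g : J -> R -> R[i])
    (l : J -> R[i]) u :
  (forall j, is_cderive (g j) u (l j)) ->
  is_cderive (fun t => \sum_(j <- r) g j t) u (\sum_(j <- r) l j).
Proof.
move=> gl; elim: r => [|j r IHr].
  rewrite big_nil; under eq_fun do rewrite big_nil.
  by split; apply: is_derive_cst.
by rewrite big_cons; under eq_fun do rewrite big_cons; apply: cderive_add.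
Qed.

Lemma nc_derive_mulr T (G : R -> ncseries R[i] T) u D C :
  is_nc_derive G u D -> is_nc_derive (fun t => G t * C) u (D * C).
Proof.
by move=> GD w; apply: cderive_sum => i; apply: cderive_mulr; apply: GD.
Qed.

Lemma nc_derive_sub T (G H : R -> ncseries R[i] T) u D E :
  is_nc_derive G u D -> is_nc_derive H u E ->
  is_nc_derive (fun t => G t - H t) u (D - E).
Proof.
move=> GD HE w; rewrite ncDE ncNE -mulrN1.
under eq_fun do rewrite ncDE ncNE -mulrN1.
by apply: cderive_add; [apply: GD|apply/cderive_mulr/HE].
Qed.

Lemma nc_derive_subst T U (y : T -> ncseries R[i] U) (G : R -> ncseries R[i] T)
    u D :
  is_nc_derive G u D ->
  is_nc_derive (fun t => nc_subst y (G t)) u (nc_subst y D).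
Proof.
move=> GD w; apply: cderive_sum => k; apply: cderive_sum => v.
by apply: cderive_mulr; apply: GD.
Qed.

Lemma nc_derive_comp T (G : R -> ncseries R[i] T) (v : R -> R) u d D :
  is_derive u 1 v d -> is_nc_derive G (v u) D ->
  is_nc_derive (G \o v) u (d%:C *: D).
Proof.
move=> vd GD w; have [reG imG] := GD w; rewrite ncZE; split.
  rewrite ReM /= mul0r subr0 mulrC; exact: is_derive1_comp.
rewrite ImM /= mul0r addr0 mulrC; exact: is_derive1_comp.
Qed.

Lemma is_derive0_itv_cst (f : R -> R) (a b : R) :
  (forall t, a < t < b -> is_derive t 1 f 0) ->
  forall s t, a < s < b -> a < t < b -> f s = f t.
Proof.
move=> f0 s t; wlog st : s t / s <= t => [hw|].
  by have [/hw//|/ltW/hw ts hs ht] := leP s t; rewrite ts.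
move=> /andP[as_ _] /andP[_ tb].
have fd x : s <= x <= t -> is_derive x 1 f 0.
  by move=> /andP[sx xt]; apply: f0;
    rewrite (lt_le_trans as_ sx) (le_lt_trans xt).
have [x|//|c _] := @MVT_segment R f (fun=> 0) s t st.
- by rewrite in_itv /= => /andP[/ltW sx /ltW xt]; apply: fd; rewrite sx.
- apply: derivable_within_continuous => x; rewrite in_itv /= => /fd fx.
  exact: (@ex_derive _ _ _ _ _ _ _ fx).
- by rewrite mul0r => /eqP; rewrite subr_eq0 => /eqP.
Qed.

Definition flow T (omega X : R -> ncseries R[i] T) : Prop :=
  forall t, 0 < t < 1 -> is_nc_derive X t (omega t * X t).

(** As [omega] has no constant term, the derivative of the coefficient at [w]
    involves the coefficients at shorter words only; these vanish by
    induction, so the coefficient at [w] is constant. *)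
Lemma flow_eq0 T (omega X : R -> ncseries R[i] T) t0 :
  (forall t, 0 < t < 1 -> omega t [::] = 0) -> flow omega X ->
  0 < t0 < 1 -> X t0 = 0 -> forall t, 0 < t < 1 -> X t = 0.
Proof.
move=> om0 Xflow t01 X0.
suff H n w t : (size w < n)%N -> 0 < t < 1 -> X t w = 0.
  by move=> t ht; apply/funext => w; apply: (H (size w).+1).
elim: n w t => // n IHn w t wn t1.
have dX s : 0 < s < 1 -> is_cderive (fun t => X t w) s 0.
  move=> s1; have := Xflow s s1 w; rewrite (@eq_ncM_low _ _ _ _ 0 n) ?om0//.
    by rewrite mulr0.
  by move=> v vn; apply: IHn.
have Xre := is_derive0_itv_cst (fun s hs => (dX s hs).1) t1 t01.
have Xim := is_derive0_itv_cst (fun s hs => (dX s hs).2) t1 t01.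
by apply/eqP; rewrite eq_complex Xre Xim X0 !eqxx.
Qed.

(** Both sides solve the equation and agree at [t0].  Right multiplication by
    a constant preserves solutions, so the inverse of [K] is never
    differentiated. *)
Lemma flow_unique T (omega K X : R -> ncseries R[i] T) t0 :
  (forall t, 0 < t < 1 -> omega t [::] = 0) -> flow omega K -> flow omega X ->
  0 < t0 < 1 -> K t0 [::] != 0 ->
  forall t, 0 < t < 1 -> X t = K t * ((K t0)^-1 * X t0).
Proof.
move=> om0 KF XF t01 K0 t t1; apply/eqP; rewrite -subr_eq0; apply/eqP.
apply: (flow_eq0 om0 _ t01 _ t1
  (X := fun t => X t - K t * ((K t0)^-1 * X t0))); last first.
  have KU : K t0 \is a GRing.unit := K0.
  by rewrite (mulVKr KU) subrr.
move=> s s1; rewrite mulrBr mulrA.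
by apply: nc_derive_sub; [apply: XF|apply/nc_derive_mulr/KF].
Qed.

End Derivatives.

(** * Coefficientwise limits *)

Section Limits.
Variables (R : realType) (F : set_system R).
Context {FF : ProperFilter F}.
Implicit Types (T U : finType).
Local Open Scope classical_set_scope.

Definition ccvg (g : R -> R[i]) (l : R[i]) : Prop :=
  complex.Re (g u) @[u --> F] --> complex.Re l /\
  complex.Im (g u) @[u --> F] --> complex.Im l.

Lemma ccvg_cst l : ccvg (fun=> l) l.
Proof. by split; apply: cvg_cst. Qed.

Lemma ccvgD f g a b : ccvg f a -> ccvg g b ->
  ccvg (fun u => f u + g u) (a + b).
Proof.
move=> [rf imf] [rg img]; split.
  by under eq_fun do rewrite ReD; rewrite ReD; apply: cvgD.
by under eq_fun do rewrite ImD; rewrite ImD; apply: cvgD.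
Qed.

Lemma ccvgM f g a b : ccvg f a -> ccvg g b ->
  ccvg (fun u => f u * g u) (a * b).
Proof.
move=> [rf imf] [rg img]; split.
  by under eq_fun do rewrite ReM; rewrite ReM; apply: cvgB; apply: cvgM.
by under eq_fun do rewrite ImM; rewrite ImM; apply: cvgD; apply: cvgM.
Qed.

Lemma ccvg_sum (J : Type) (r : seq J) (f : J -> R -> R[i]) (l : J -> R[i]) :
  (forall j, ccvg (f j) (l j)) ->
  ccvg (fun u => \sum_(j <- r) f j u) (\sum_(j <- r) l j).
Proof.
move=> fl; elim: r => [|j r IHr].
  rewrite big_nil; under eq_fun do rewrite big_nil; exact: ccvg_cst.
by rewrite big_cons; under eq_fun do rewrite big_cons; apply: ccvgD.
Qed.

Lemma ccvgX f a n : ccvg f a -> ccvg (fun u => f u ^+ n) (a ^+ n).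
Proof.
move=> fa; elim: n => [|n IHn]; first exact: ccvg_cst.
by rewrite exprS; under eq_fun do rewrite exprS; apply: ccvgM.
Qed.

Lemma ccvg_unique f a b : ccvg f a -> ccvg f b -> a = b.
Proof.
move=> [ra ia] [rb ib]; apply/eqP; rewrite eq_complex.
by rewrite (cvg_unique _ ra rb)// (cvg_unique _ ia ib)// !eqxx.
Qed.

Lemma nc_cvgM T (G H : R -> ncseries R[i] T) a b : nc_cvg F G a ->
  nc_cvg F H b -> nc_cvg F (fun u => G u * H u) (a * b).
Proof.
by move=> Ga Hb w; apply: ccvg_sum => i; apply: ccvgM; [apply: Ga|apply: Hb].
Qed.

Lemma nc_cvg_subst T U (y : T -> ncseries R[i] U) (G : R -> ncseries R[i] T) a :
  nc_cvg F G a -> nc_cvg F (fun u => nc_subst y (G u)) (nc_subst y a).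
Proof.
move=> Ga w; apply: ccvg_sum => k; apply: ccvg_sum => v.
by apply: ccvgM; [apply: Ga|apply: ccvg_cst].
Qed.

Lemma nc_cvg_exp T (x : ncseries R[i] T) (a : R -> R) (l : R) :
  a u @[u --> F] --> l ->
  nc_cvg F (fun u => nc_exp ((a u)%:C *: x)) (nc_exp (l%:C *: x)).
Proof.
move=> al w; apply: ccvg_sum => k; apply: ccvgM; last exact: ccvg_cst.
rewrite exprZn ncZE; under eq_fun do rewrite exprZn ncZE.
apply: ccvgM; last exact: ccvg_cst.
by apply: ccvgX; split => //=; apply: cvg_cst.
Qed.

Lemma nc_cvg_near T (G H : R -> ncseries R[i] T) a :
  (\forall u \near F, G u = H u) -> nc_cvg F G a -> nc_cvg F H a.
Proof.
move=> GH Ga w; have [re im] := Ga w.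
split; [apply: cvg_trans re|apply: cvg_trans im]; apply: near_eq_cvg;
  by apply: filterS GH => u ->.
Qed.

(** If [E <> 1], let [e] be the component of [E - 1] of lowest degree [n].  In
    degree [n] the product is that of [M * Q], plus [e] multiplied by constant
    terms tending to [1]; hence [e = 0].  Above degree [n], [P] may diverge. *)
Lemma nc_cvg_conj_eq1 T (M P P' Q : R -> ncseries R[i] T) E :
  (forall u, P u * P' u = 1) -> nc_cvg F M 1 -> nc_cvg F Q 1 ->
  nc_cvg F (fun u => M u * (P u * E * P' u) * Q u) 1 -> E = 1.
Proof.
move=> PP' M1 Q1 lim; have MQ := nc_cvgM M1 Q1; rewrite mulr1 in MQ.
suff H n w : (size w < n)%N -> (E - 1) w = 0.
  apply/funext => w; have := H _ w (ltnSn _); rewrite ncDE ncNE.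
  by move/eqP; rewrite subr_eq0 => /eqP.
elim: n w => // n IHn w.
rewrite ltnS leq_eqVlt => /orP[/eqP wn|]; last exact: IHn.
set e := E - 1 in IHn *.
have lowl (f g : ncseries R[i] T) :
    (forall v, (size v < n)%N -> g v = 0) -> forall v,
    (size v < n)%N -> (f * g) v = 0.
  by move=> g0 v vn; apply: (@ncM_eq0 _ _ 0 n).
have lowr (f g : ncseries R[i] T) :
    (forall v, (size v < n)%N -> g v = 0) -> forall v,
    (size v < n)%N -> (g * f) v = 0.
  by move=> g0 v vn; apply: (@ncM_eq0 _ _ n 0) => //; rewrite addn0.
have key u : (M u * (P u * E * P' u) * Q u) w =
    (M u * Q u) w + (M u * Q u) [::] * e w.
  have -> : E = 1 + e by rewrite addrCA subrr addr0.
  rewrite mulrDr mulr1 mulrDl PP' mulrDr mulr1 mulrDl ncDE; congr (_ + _).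
  have e1 := lowl (P u) _ IHn; have e2 := lowr (P' u) _ e1.
  have e3 := lowl (M u) _ e2; rewrite -wn in IHn e1 e2 e3.
  rewrite ncM_lowest_l// ncM_lowest_r// ncM_lowest_l// ncM_lowest_r// ncM_nil.
  have PP1 : P u [::] * P' u [::] = 1 by rewrite -ncM_nil PP' nc1E.
  by rewrite -[RHS]mulr1 -PP1; ring.
have lim1 := ccvgD (MQ w) (ccvgM (MQ [::]) (ccvg_cst (e w))).
have lim2 : ccvg (fun u => (M u * Q u) w + (M u * Q u) [::] * e w)
    ((1 : ncseries R[i] T) w).
  by under eq_fun do rewrite -key; exact: (lim w).
have := ccvg_unique lim1 lim2; rewrite [_ [::]]nc1E mul1r => /eqP.
by rewrite -subr_eq0 addrAC subrr add0r => /eqP.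
Qed.

End Limits.

(** * Comparing solutions with prescribed asymptotics *)

Section Connection.
Variables (R : realType) (T : finType).
Local Notation S := (ncseries R[i] T).

Lemma nc_exp_addZ (x : S) (s t : R) : x [::] = 0 ->
  nc_exp ((s + t)%:C *: x) = nc_exp (s%:C *: x) * nc_exp (t%:C *: x).
Proof.
move=> x0; rewrite rmorphD scalerDl nc_expD ?ncZE ?x0 ?mulr0//.
by rewrite /GRing.comm -!scalerAl -!scalerAr !scalerA mulrC.
Qed.

Lemma solvesP (omega G : R -> S) u : solves omega G -> 0 < u < 1 ->
  G u [::] = 1 /\ is_nc_derive G u (omega u * G u).
Proof.
move=> /[apply] -[[x _ Gx] [D GD <-]].
have G1 : G u [::] = 1 by rewrite Gx nc_exp_nil.
have GU : G u \is a GRing.unit.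
  by rewrite -[_ \is a _]/(G u [::] != 0) G1 oner_eq0.
by rewrite mulrVK.
Qed.

Lemma solves_subst (U : finType) (y : T -> ncseries R[i] U) (omega H : R -> S) :
  (forall i, y i [::] = 0) -> solves omega H ->
  flow (fun z => nc_subst y (omega z)) (fun z => nc_subst y (H z)).
Proof.
move=> y0 Hsol z z01; rewrite -nc_substM//.
by apply: nc_derive_subst; have [] := solvesP Hsol z01.
Qed.

(** If [K ~ e^(p x)] and [X ~ e^(q x)] with [q - p] tending to [c], then
    [X = K e^(c x)].  Indeed [X = K C] for a constant [C]; with
    [E = C e^(-c x)], the product [X e^(-q x)] is
    [(K e^(-p x)) (e^(p x) E e^(-p x)) e^((c-(q-p)) x)], where the first and
    last factors tend to [1]. *)
Lemma flow_connection (omega K X : R -> S) (F : set_system R) (x : S)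
    (p q : R -> R) (c : R) :
  ProperFilter F -> (\forall z \near F, 0 < z < 1) ->
  (forall z, 0 < z < 1 -> omega z [::] = 0) ->
  flow omega K -> flow omega X ->
  (forall z, 0 < z < 1 -> K z [::] = 1) -> x [::] = 0 ->
  nc_cvg F (fun z => K z * nc_exp ((p z)%:C *: - x)) 1 ->
  nc_cvg F (fun z => X z * nc_exp ((q z)%:C *: - x)) 1 ->
  (q z - p z @[z --> F] --> c)%classic ->
  forall z, 0 < z < 1 -> X z = K z * nc_exp (c%:C *: x).
Proof.
move=> FF F01 om0 KF XF K1 x0 Kp Xq qp z z01.
pose e (s : R) := nc_exp (s%:C *: x).
have eD s t : e (s + t) = e s * e t by apply: nc_exp_addZ.
have e0 : e 0 = 1 by rewrite /e scale0r nc_exp0.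
have eN (s : R) : nc_exp (s%:C *: - x) = e (- s).
  by rewrite /e scalerN rmorphN scaleNr.
have half : 0 < (2^-1 : R) < 1 by lra.
have XK := flow_unique om0 KF XF half; rewrite K1// oner_eq0 in XK.
set C := _^-1 * _ in XK; have {}XK t (t01 : 0 < t < 1) := XK isT t t01.
have Kp' : nc_cvg F (fun z => K z * e (- p z)) 1.
  by apply: nc_cvg_near Kp; apply: nearW => u; rewrite eN.
have Q1 : nc_cvg F (fun z => e (c - (q z - p z))) 1.
  rewrite -e0; apply: nc_cvg_exp; rewrite -[X in (_ --> X)%classic](subrr c).
  by apply: cvgB => //; apply: cvg_cst.
rewrite -/(e c) XK//; move: XK; clearbody e C => XK.
suff C1 : C * e (- c) = 1.
  by rewrite -[C]mulr1 -e0 -(addNr c) eD [C * _]mulrA C1 mul1r.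
apply: (nc_cvg_conj_eq1 _ Kp' Q1 (P := fun z => e (p z))
  (P' := fun z => e (- p z))).
  by move=> u; rewrite -eD subrr e0.
apply: nc_cvg_near Xq; apply: filterS F01 => u u01.
rewrite /= XK// eN.
have -> : K u * e (- p u) * (e (p u) * (C * e (- c)) * e (- p u)) =
    K u * C * (e (- c) * e (- p u)).
  rewrite -[LHS]mulrA -[RHS]mulrA; congr (_ * _).
  by rewrite !mulrA -eD addNr e0 mul1r.
by rewrite -[RHS]mulrA -!eD; congr (_ * e _); ring.
Qed.

End Connection.

(** * The change of variable *)

Section ChangeOfVariable.
Variable R : realType.
Implicit Types z : R.
Local Open Scope classical_set_scope.

(** A double cover of the line, ramified over [1] and infinity: this is why
    [2B] and [-2(A+B)] appear in the theorem. *)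
Definition uvar (z : R) : R := 4 * z * ((1 + z)^-1) ^+ 2.

Lemma uvarC z : 0 < z < 1 -> 1 - uvar z = (1 - z) ^+ 2 * ((1 + z)^-1) ^+ 2.
Proof. by move=> z01; rewrite /uvar; field; lra. Qed.

Lemma uvar_itv z : 0 < z < 1 -> 0 < uvar z < 1.
Proof.
move=> z01; rewrite -[_ < 1]subr_gt0 uvarC// /uvar !mulr_gt0// ?exprn_gt0//;
  rewrite ?invr_gt0; lra.
Qed.

Lemma is_derive_uvar z : 0 < z < 1 ->
  is_derive z 1 uvar (4 * (1 - z) * ((1 + z)^-1) ^+ 3).
Proof.
move=> z01; have z1 : 1 + z != 0 by lra.
have -> : uvar = (fun t => (4 * t) * ((1 + t)^-1 * (1 + t)^-1)).
  by apply/funext.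
have d1 : is_derive z 1 (fun t : R => 4 * t) (4 *: 1) by exact: is_deriveZ.
have d2 : is_derive z 1 (fun t : R => 1 + t) 1.
  rewrite -[X in is_derive _ _ _ X]add0r.
  exact: is_derive_add.
have d3 := is_deriveV z1 d2.
apply: (is_derive_eq (is_deriveM d1 (is_deriveM d3 d3))).
by rewrite !fctE /GRing.scale /=; field.
Qed.

Lemma cvg_to_within (F : set_system R) (FF : Filter F) (f : R -> R)
    (D : set R) (l : R) :
  f z @[z --> F] --> l -> (\forall z \near F, D (f z)) ->
  f z @[z --> F] --> within D (nbhs l).
Proof. by move=> fl Df A /fl; apply: filterS2 Df => z Dz; apply. Qed.

Lemma cvg_1D (a : R) : (1 + z) @[z --> a] --> 1 + a.
Proof. by apply: cvgD; [exact: cvg_cst|exact: cvg_id]. Qed.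

Lemma cvg_uvar (a : R) : 1 + a != 0 -> uvar z @[z --> a] --> uvar a.
Proof.
move=> a1; have i1 : (1 + z)^-1 @[z --> a] --> (1 + a)^-1.
  by apply: cvgV => //; apply: cvg_1D.
apply: cvgM; last exact: cvgM.
by apply: cvgM; [exact: cvg_cst|exact: cvg_id].
Qed.

Lemma near0_itv : \forall z \near (0 : R)^'+, 0 < z < 1.
Proof.
by near=> z; apply/andP; split; near: z;
  [exact: nbhs_right_gt|exact: nbhs_right_lt].
Unshelve. all: by end_near. Qed.

Lemma near1_itv : \forall z \near (1 : R)^'-, 0 < z < 1.
Proof.
by near=> z; apply/andP; split; near: z;
  [exact: nbhs_left_gt|exact: nbhs_left_lt].
Unshelve. all: by end_near. Qed.

Lemma uvar_at0 : uvar z @[z --> 0^'+] --> 0^'+.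
Proof.
apply: cvg_to_within; last by apply: filterS near0_itv => z /uvar_itv/andP[].
apply: cvg_at_right_filter; rewrite -[X in _ --> X](_ : uvar 0 = 0).
  by apply: cvg_uvar; rewrite addr0 oner_eq0.
by rewrite /uvar mulr0 mul0r.
Qed.

Lemma uvar_at1 : uvar z @[z --> 1^'-] --> 1^'-.
Proof.
apply: cvg_to_within; last by apply: filterS near1_itv => z /uvar_itv/andP[].
apply: cvg_at_left_filter; rewrite -[X in _ --> X](_ : uvar 1 = 1).
  by apply: cvg_uvar; rewrite lt0r_neq0 ?addr_gt0.
by rewrite /uvar; field.
Qed.

Lemma cvg_ln1D (a : R) : 0 < 1 + a -> ln (1 + z) @[z --> a] --> ln (1 + a).
Proof.
by move=> a1; apply: (cvg_comp _ _ (@cvg_1D a)); apply: continuous_ln.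
Qed.

Lemma ln_uvar z : 0 < z < 1 -> ln (uvar z) - ln z = ln 4 - 2 * ln (1 + z).
Proof.
move=> z01; have z0 : 0 < z by lra. have z1 : 0 < 1 + z by lra.
have v0 : 0 < (1 + z)^-1 by rewrite invr_gt0.
rewrite /uvar lnM ?posrE ?mulr_gt0 ?exprn_gt0// [ln (4 * z)]lnM ?posrE//.
rewrite lnXn// lnV ?posrE//.
by rewrite mulr2n; ring.
Qed.

Lemma ln_1Buvar z : 0 < z < 1 ->
  ln (1 - uvar z) - 2 * ln (1 - z) = - (2 * ln (1 + z)).
Proof.
move=> z01; have z0 : 0 < 1 - z by lra. have z1 : 0 < 1 + z by lra.
have v0 : 0 < (1 + z)^-1 by rewrite invr_gt0.
rewrite uvarC// lnM ?posrE ?exprn_gt0// !lnXn// lnV ?posrE//.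
by rewrite !mulr2n; ring.
Qed.

Lemma ln_uvar_at0 : ln (uvar z) - ln z @[z --> 0^'+] --> (ln 4 : R).
Proof.
have : ln 4 - 2 * ln (1 + z) @[z --> 0^'+] --> (ln 4 : R).
  rewrite -[X in _ --> X](_ : ln 4 - 2 * ln (1 + 0) = ln 4 :> R).
    by apply: cvg_at_right_filter; apply: cvgB; [exact: cvg_cst|];
      apply: cvgM; [exact: cvg_cst|apply: cvg_ln1D; lra].
  by rewrite addr0 ln1 mulr0 subr0.
apply: cvg_trans; apply: near_eq_cvg.
by apply: filterS near0_itv => z /ln_uvar ->.
Qed.

Lemma ln_1Buvar_at1 :
  ln (1 - uvar z) - 2 * ln (1 - z) @[z --> 1^'-] --> (- ln 4 : R).
Proof.
have : - (2 * ln (1 + z)) @[z --> 1^'-] --> (- ln 4 : R).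
  rewrite -[X in _ --> X](_ : - (2 * ln (1 + 1)) = - ln 4 :> R).
    by apply: cvg_at_left_filter; apply: cvgN;
      apply: cvgM; [exact: cvg_cst|apply: cvg_ln1D; lra].
  have -> : 4 = (1 + 1) ^+ 2 :> R by ring.
  by rewrite lnXn ?addr_gt0// mulr_natl.
apply: cvg_trans; apply: near_eq_cvg.
by apply: filterS near1_itv => z /ln_1Buvar ->.
Qed.

End ChangeOfVariable.

(** * Pulling back the differential equation *)

Section Pullback.
Local Open Scope classical_set_scope.
Variable R : realType.
Local Notation A := (f2_A R).
Local Notation B := (f2_B R).
Implicit Types (t z : R).

(** The substitution of the theorem, [A |-> A], [b0 |-> 2B],
    [b1 |-> -2(A+B)], convertible to the letter map in [f3_eval]. *)
Definition letter_images (i : 'I_3) : ncseries R[i] 'I_2 :=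
  nth 0 [:: A; 2 *: B; (- 2) *: (A + B)] i.

Lemma letter_images_nil i : letter_images i [::] = 0.
Proof.
case: i => [[|[|[|//]]] hi];
  by rewrite /letter_images /= ?ncZE ?ncDE ?nc0E ?addr0 ?mulr0.
Qed.

Lemma subst_f3_A : nc_subst letter_images (f3_A R) = A.
Proof. by rewrite nc_subst_gen//; exact: letter_images_nil. Qed.
Lemma subst_f3_b0 : nc_subst letter_images (f3_b0 R) = 2 *: B.
Proof. by rewrite nc_subst_gen//; exact: letter_images_nil. Qed.
Lemma subst_f3_b1 : nc_subst letter_images (f3_b1 R) = (- 2) *: (A + B).
Proof. by rewrite nc_subst_gen//; exact: letter_images_nil. Qed.

(** The coefficients of [A] and [B] are [u'/u = 1/z - 2/(z+1)] and
    [u'/(u-1) = 2/(z-1) - 2/(z+1)]. *)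
Lemma form_pullback z : 0 < z < 1 ->
  (4 * (1 - z) * ((1 + z)^-1) ^+ 3)%:C *: form_Phi (uvar z) =
  nc_subst letter_images (form_Psi2 z).
Proof.
move=> z01; rewrite /form_Psi2 /form_Phi !nc_substD !nc_substZ.
rewrite subst_f3_A subst_f3_b0 subst_f3_b1.
rewrite scalerDr !scalerA -!rmorphM /=.
have -> : 4 * (1 - z) * (1 + z)^-1 ^+ 3 * (uvar z)^-1 = z^-1 - 2 * (z + 1)^-1.
  by rewrite /uvar; field; lra.
have -> : 4 * (1 - z) * (1 + z)^-1 ^+ 3 * (uvar z - 1)^-1 =
    2 * (z - 1)^-1 - 2 * (z + 1)^-1.
  have -> : uvar z - 1 = - ((1 - z) ^+ 2 * ((1 + z)^-1) ^+ 2).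
    by rewrite -uvarC// opprB.
  by field; lra.
apply/funext => w; rewrite !ncDE !ncZE !ncDE.
by rewrite !rmorphB !rmorphM !rmorph_nat; ring.
Qed.

Lemma flow_uvar (G : R -> ncseries R[i] 'I_2) : solves (@form_Phi R) G ->
  flow (fun z => nc_subst letter_images (form_Psi2 z)) (G \o @uvar R).
Proof.
move=> Gsol z z01; have [_ GD] := solvesP Gsol (uvar_itv z01).
rewrite -form_pullback// -scalerAl.
exact: nc_derive_comp (is_derive_uvar z01) GD.
Qed.

Lemma subst_form_nil z : nc_subst letter_images (form_Psi2 z) [::] = 0.
Proof.
rewrite nc_subst_nil; last exact: letter_images_nil.
by rewrite /form_Psi2 !ncDE !ncZE !mulr0 !addr0.
Qed.

(** The comparison at either end point: [s] is the local parameter there and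
    [x] the residue of the form defining [Phi]; [k] is the ramification index
    of [uvar], so that [s (uvar z)] behaves like [e^c (s z)^k]. *)
Lemma connection_uvar (F F' : set_system R) {FF : ProperFilter F}
    (s : R -> R) (i : 'I_3) (x : ncseries R[i] 'I_2) (k c : R)
    (G : R -> ncseries R[i] 'I_2) (H : R -> ncseries R[i] 'I_3) :
  (\forall z \near F, 0 < z < 1) -> uvar z @[z --> F] --> F' ->
  x [::] = 0 -> letter_images i = k%:C *: x ->
  ln (s (uvar z)) - k * ln (s z) @[z --> F] --> c ->
  solves (@form_Phi R) G -> solves (@form_Psi2 R) H ->
  nc_cvg F' (fun u => G u * nc_pow (s u) (- x)) 1 ->
  nc_cvg F (fun z => H z * nc_pow (s z) (- nc_gen _ i)) 1 ->
  forall z, 0 < z < 1 ->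
  G (uvar z) = nc_subst letter_images (H z) * nc_exp (c%:C *: x).
Proof.
have y0 := letter_images_nil.
move=> F01 uF x0 yi lnc Gsol Hsol Glim Hlim.
apply: (flow_connection (F := F) (p := fun z => k * ln (s z))
  (q := fun z => ln (s (uvar z)))
  (omega := fun z => nc_subst letter_images (form_Psi2 z))
  (K := fun z => nc_subst letter_images (H z)) (X := G \o @uvar R));
  last exact: lnc.
- exact: F01.
- by move=> z _; apply: subst_form_nil.
- exact: solves_subst.
- exact: flow_uvar.
- by move=> z z01; rewrite nc_subst_nil//; have [] := solvesP Hsol z01.
- exact: x0.
- have lim : nc_cvg F (fun z =>
      nc_subst letter_images (H z * nc_pow (s z) (- nc_gen _ i))) 1.
    by rewrite -(nc_subst1 y0); apply: nc_cvg_subst.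
  apply: (nc_cvg_near _ lim); apply: nearW => z.
  have gen0 : ((ln (s z))%:C *: - nc_gen _ i : ncseries R[i] 'I_3) [::] = 0.
    by rewrite ncZE ncNE oppr0 mulr0.
  rewrite (nc_substM y0) (nc_subst_exp y0 gen0); congr (_ * nc_exp _).
  rewrite nc_substZ -scaleN1r nc_substZ (nc_subst_gen y0) scaleN1r yi.
  by rewrite !scalerN scalerA -rmorphM mulrC.
- by move=> w; have [re im] := Glim w; split;
    [apply: cvg_comp re|apply: cvg_comp im].
Qed.

End Pullback.

Theorem proposition2p3 (R : realType)
  (Phi : ncseries R[i] 'I_2) (Psi2 : ncseries R[i] 'I_3)
  (hPhi : is_Phi Phi) (hPsi2 : is_Psi2 Psi2) :
  let A := f2_A R in
  let B := f2_B R in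
  Phi = nc_pow 4 B
        * f3_eval Psi2 A (2 *: B) ((- 2) *: (A + B))
        * nc_pow 4 A.
Proof.
move=> A B; rewrite /f3_eval -/(letter_images R).
have y0 := @letter_images_nil R.
case: hPhi => G0 [G1 [G0sol G0lim G1sol G1lim PhiE]].
case: hPsi2 => H0 [H1 [H0sol H0lim H1sol H1lim Psi2E]].
have z01 : 0 < (2^-1 : R) < 1 by lra.
rewrite (Psi2E _ z01) (PhiE _ (uvar_itv z01)).
(* At 0 the parameter is [z], unramified; at 1 it is [1 - z], ramified of
   index 2. *)
have -> : G0 (uvar 2^-1) = nc_subst (@letter_images R) (H0 2^-1) * nc_pow 4 A.
  apply: (connection_uvar (F := (0^'+)%classic) (s := id) (k := 1)
    (near0_itv R) (@uvar_at0 R) _ _ _ G0sol H0sol G0lim H0lim z01).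
  - by [].
  - by rewrite scale1r.
  - by under eq_fun do rewrite mul1r; exact: ln_uvar_at0.
have -> : G1 (uvar 2^-1) =
    nc_subst (@letter_images R) (H1 2^-1) * nc_exp ((- ln 4)%:C *: B).
  apply: (connection_uvar (F := (1^'-)%classic) (s := fun z => 1 - z) (k := 2)
    (near1_itv R) (@uvar_at1 R) _ _ (@ln_1Buvar_at1 R) G1sol H1sol
    G1lim H1lim z01).
  - by [].
  - by rewrite rmorph_nat.
have [H1_1 _] := solvesP H1sol z01.
have H1U : H1 2^-1 \is a GRing.unit.
  by rewrite -[_ \is a _]/(H1 2^-1 [::] != 0) H1_1 oner_eq0.
rewrite nc_substM// !mulrA; congr (_ * _ * _).
apply: nc_inv_eq.
  rewrite -mulrA [X in _ * X]mulrA -nc_exp_addZ// addNr scale0r nc_exp0 mul1r.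
  by rewrite -nc_substM// mulrV// nc_subst1.
by rewrite ncM_nil nc_subst_nil// H1_1 nc_exp_nil mulr1 oner_eq0.
Qed.
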